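(* Let $\mathbb{K}$ be a field of characteristic not $2$ and $n\geq 2$. Let $\mathcal{V}$ be a linear subspace of $M_n(\mathbb{K})$ of dimension $\binom{n}{2}+1$ in which every matrix has at most one nonzero eigenvalue in $\overline{\mathbb{K}}$. Assume there exist a $\mathcal{V}$-good vector $x\in\mathbb{K}^n$ and a matrix $A\in\mathcal{V}$ whose column space is $\mathbb{K}x$. Then $\mathcal{V}$ is similar to $\mathbb{K}E_{n,n}\oplus\mathrm{NT}_n(\mathbb{K})$ (the space of upper-triangular matrices whose first $n-1$ diagonal entries vanish).
   Context: $\overline{\mathbb{K}}$ is an algebraic closure of $\mathbb{K}$. A nonzero $x\in\mathbb{K}^n$ is $\mathcal{V}$-good if no $M\in\mathcal{V}$ has column space $\mathbb{K}x$ and trace $0$. $E_{n,n}$ is the matrix unit with $1$ in position $(n,n)$; $\mathrm{NT}_n(\mathbb{K})$ is the space of strictly upper-triangular matrices. Similar means conjugate by an invertible matrix. *)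

(* Defs.v *)
From HB Require Import structures.
From mathcomp Require Import all_boot all_order all_algebra all_field.
Set Implicit Arguments. Unset Strict Implicit. Unset Printing Implicit Defensive.
Import Order.TTheory GRing.Theory Num.Theory.
Local Open Scope ring_scope.

(* M has at most one nonzero eigenvalue in an algebraic closure of K.
   Stated as: in every algebraically closed field L containing K (via a
   ring morphism f), M has at most one nonzero eigenvalue. *)
Definition at_most_one_nonzero_eigenvalue (K : fieldType) (n : nat)
  (M : 'M[K]_n) : Prop :=
  forall (L : closedFieldType) (f : {rmorphism K -> L}) (a b : L),
    a != 0 -> b != 0 ->
    eigenvalue (map_mx f M) a -> eigenvalue (map_mx f M) b -> a = b.

Definition colspace_is (K : fieldType) (n : nat) (M : 'M[K]_n) (x : 'cV[K]_n)
  : Prop := (M^T == x^T)%MS.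

Definition good (K : fieldType) (n : nat) (V : 'A[K]_n) (x : 'cV[K]_n) : Prop :=
  x != 0 /\ ~ (exists M : 'M[K]_n, (M \in V)%MS /\ colspace_is M x /\ \tr M = 0).

Definition En_NT (K : fieldType) (n : nat) (M : 'M[K]_n) : Prop :=
  (forall i j : 'I_n, (j < i)%N -> M i j = 0) /\
  (forall i : 'I_n, (i < n.-1)%N -> M i i = 0).

(* Main.v *)
Require Import Defs.
From HB Require Import structures.
From mathcomp Require Import all_boot all_order fingroup perm all_algebra all_field ring.
From mathcomp Require Import generic_quotient.
From mathcomp Require Import boolp classical_sets filter.
Set Implicit Arguments. Unset Strict Implicit. Unset Printing Implicit Defensive.
Import GRing.Theory.
Local Open Scope ring_scope.

(* Scale [A] to have trace [1], so that [A = u v] has rank one, and let [V0] be the space of the trace-zero elements of [V]; it has dimension [C(n, 2)]. For [M] in [V0] the characteristic polynomial of [M + t A] is affine in [t]. Over an algebraically closed extension it equals [X^(n - k) (X - l)^k] with [k l = t]; comparing [t = -1, 0, 1] with the help of the operator [p |-> n p - X p'] forces [M] to be nilpotent.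

A linear space of nilpotent matrices, in characteristic not [2], satisfies [tr (A B) = tr (A^2 B) = 0]: look at [det (1 + w C)] at [w = z] and [w = - z], where [C = (1 + z A)^-1 B]. These identities bound its dimension by [C(n, 2)] and still do so after adjoining [A^2]. By maximality [V0] is closed under squares, hence under the Jordan product, and Jacobson's form of Engel's theorem triangularizes it, so [V0] is conjugate to the whole of [NT_n]. Finally [tr (M A) = 0] on [V0] makes [A] upper triangular in the same basis, and goodness of [x] forces the last coordinate of [x] to be nonzero, so that only the last column of [A] is nonzero.

The closed extension of an arbitrary field is an ultraproduct of algebraic closures of its finitely generated, hence countable, subfields. *)

(** * Algebraically closed extensions *)

Section GeneratedSubfield.
Variables (K : fieldType) (s : seq K).

(** Each stage is a finite list, so an element of the generated subfield is coded by a stage and an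
    index in it; this makes the subfield countable. *)
Fixpoint gen_stage (n : nat) : seq K :=
  if n is m.+1 then
    gen_stage m ++ [seq a - b | a <- gen_stage m, b <- gen_stage m]
                ++ [seq a / b | a <- gen_stage m, b <- gen_stage m]
  else 1 :: s.

Definition gen_subfield : {pred K} := fun a => `[< exists n, a \in gen_stage n >].

Lemma gen_stage_le m n : (m <= n)%N -> {subset gen_stage m <= gen_stage n}.
Proof.
move=> /subnK <-; elim: (n - m)%N => [|k IH] a /= am //.
by rewrite mem_cat IH.
Qed.

Lemma gen_subfield_divring : divring_closed gen_subfield.
Proof.
split=> [|a b|a b].
- by apply/asboolP; exists 0%N; rewrite mem_head.
- move=> /asboolP [i ai] /asboolP [j bj]; apply/asboolP; exists (maxn i j).+1.
  rewrite /= !mem_cat; apply/orP; right; apply/orP; left.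
  apply: allpairs_f; first exact: (gen_stage_le (leq_maxl i j)).
  exact: (gen_stage_le (leq_maxr i j)).
- move=> /asboolP [i ai] /asboolP [j bj]; apply/asboolP; exists (maxn i j).+1.
  rewrite /= !mem_cat; apply/orP; right; apply/orP; right.
  apply: allpairs_f; first exact: (gen_stage_le (leq_maxl i j)).
  exact: (gen_stage_le (leq_maxr i j)).
Qed.

HB.instance Definition _ := GRing.isDivringClosed.Build K gen_subfield gen_subfield_divring.

Record gen_sub := GenSub { gen_val : K; _ : gen_val \in gen_subfield }.
HB.instance Definition _ := [isSub for gen_val].
HB.instance Definition _ := [Choice of gen_sub by <:].
HB.instance Definition _ := [SubChoice_isSubComUnitRing of gen_sub by <:].
HB.instance Definition _ := [SubComUnitRing_isSubIntegralDomain of gen_sub by <:].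
HB.instance Definition _ := [SubIntegralDomain_isSubField of gen_sub by <:].

Lemma gen_sub_stage (x : gen_sub) : exists n, gen_val x \in gen_stage n.
Proof. by case: x => a /= ga; apply/asboolP. Qed.

Definition gen_code (x : gen_sub) : nat * nat :=
  let n := ex_minn (gen_sub_stage x) in (n, index (gen_val x) (gen_stage n)).
Definition gen_decode (c : nat * nat) : option gen_sub :=
  insub (nth 0 (gen_stage c.1) c.2).

Lemma gen_codeK : pcancel gen_code gen_decode.
Proof.
move=> x; rewrite /gen_decode /gen_code /=; case: ex_minnP => n xn _.
by rewrite nth_index // valK.
Qed.
HB.instance Definition _ := PCanIsCountable gen_codeK.

Lemma local_embedding : exists (L : closedFieldType) (g : K -> L), g 1 = 1 /\
  {in s &, forall a b, g (a - b) = g a - g b /\ g (a * b) = g a * g b}.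
Proof.
have [L [f _]] := countable_algebraic_closure gen_sub.
(* Outside the generated subfield the map takes the junk value 0. *)
exists L, (fun a => oapp f 0 (insub a)).
have E a (ha : a \in gen_subfield) : oapp f 0 (insub a) = f (GenSub ha).
  by rewrite insubT.
have sD a : a \in s -> a \in gen_subfield.
  by move=> sa; apply/asboolP; exists 0%N; rewrite inE sa orbT.
split; first by rewrite (E _ (rpred1 _)) -(rmorph1 f); congr (f _); apply: val_inj.
move=> a b /sD ha /sD hb.
rewrite (E _ ha) (E _ hb) (E _ (rpredB ha hb)) (E _ (rpredM ha hb)).
by rewrite -rmorphB -rmorphM; split; congr (f _); apply: val_inj.
Qed.
End GeneratedSubfield.

(** The product ring is divided by the ideal of families that vanish on a set of [U]. Inverses and
    roots of monic equations are chosen coordinatewise; the index [i0] keeps the product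
    nontrivial. *)
Lemma ultraproduct_closedField (I : Type) (i0 : I) (L : I -> closedFieldType)
    (U : set_system I) :
  UltraFilter U ->
  exists (F : closedFieldType) (q : (forall i, L i) -> F),
    [/\ q (fun=> 1) = 1,
        forall f g, U [set i | f i = g i]%classic -> q f = q g,
        forall f g, q (fun i => f i - g i) = q f - q g
      & forall f g, q (fun i => f i * g i) = q f * q g].
Proof.
move=> ultU; pose P : choiceType := forall i, L i.
have PadA : associative (fun f g : P => (fun i => f i + g i) : P).
  by move=> f g h; apply: functional_extensionality_dep => i; rewrite addrA.
have PadC : commutative (fun f g : P => (fun i => f i + g i) : P).
  by move=> f g; apply: functional_extensionality_dep => i; rewrite addrC.
have Pad0 : left_id ((fun=> 0) : P) (fun f g : P => (fun i => f i + g i) : P).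
  by move=> f; apply: functional_extensionality_dep => i; rewrite add0r.
have PadN : left_inverse ((fun=> 0) : P) (fun f : P => (fun i => - f i) : P)
    (fun f g : P => (fun i => f i + g i) : P).
  by move=> f; apply: functional_extensionality_dep => i; rewrite addNr.
pose Pz : zmodType := HB.pack P (GRing.isZmodule.Build P PadA PadC Pad0 PadN).
have PmulA : associative (fun f g : Pz => (fun i => f i * g i) : Pz).
  by move=> f g h; apply: functional_extensionality_dep => i; rewrite mulrA.
have PmulC : commutative (fun f g : Pz => (fun i => f i * g i) : Pz).
  by move=> f g; apply: functional_extensionality_dep => i; rewrite mulrC.
have Pmul1 : left_id ((fun=> 1) : Pz) (fun f g : Pz => (fun i => f i * g i) : Pz).
  by move=> f; apply: functional_extensionality_dep => i; rewrite mul1r.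
have PmulD : left_distributive (fun f g : Pz => (fun i => f i * g i) : Pz) +%R.
  by move=> f g h; apply: functional_extensionality_dep => i; rewrite mulrDl.
have P10 : ((fun=> 1) : Pz) != 0.
  apply/eqP => /(congr1 (fun f : Pz => f i0)) /eqP; apply/negP; exact: oner_neq0.
pose Pr : comNzRingType := HB.pack Pz
  (GRing.Zmodule_isComNzRing.Build Pz PmulA PmulC Pmul1 PmulD P10).
pose J : {pred Pr} := fun f => `[< U [set i | f i = 0]%classic >].
have JP (f : Pr) : reflect (U [set i | f i = 0]%classic) (f \in J) by apply: asboolP.
have J_ideal : idealr_closed J.
  split=> [||a f g].
  - by apply/JP; apply: filterS filterT => i.
  - apply/negP => /JP /filter_ex [i /eqP]; apply/negP; exact: oner_neq0.
  - move=> /JP Uf /JP Ug; apply/JP; apply: filterS (filterI Uf Ug) => i /= [fi gi].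
    by transitivity (a i * f i + g i) => //; rewrite fi gi mulr0 addr0.
pose IaM := GRing.isZmodClosed.Build _ J (idealr_closedB J_ideal).
pose IpM := isProperIdeal.Build _ J (idealr_closed_nontrivial J_ideal).
pose Jid : idealr _ := HB.pack J IaM IpM.
pose E : comNzRingType := {ideal_quot Jid}.
pose q : {rmorphism Pr -> E} := \pi_E%qT.
have qE (f g : Pr) : q f = q g <-> U [set i | f i = g i]%classic.
  have -> : (q f = q g) <-> (f - g \in J).
    by rewrite -[f - g \in J]/(f - g \in Jid) Quotient.idealrBE; split => [/eqP|/eqP].
  split=> [/JP|] H; last apply/JP.
    apply: filterS H => i /= H; apply/eqP; rewrite -subr_eq0; exact/eqP.
  by apply: filterS H => i /= fg; transitivity (f i - g i) => //; rewrite fg subrr.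
have qK (x : E) : q (repr x) = x by rewrite /q /= reprK.
pose inv (x : E) : E := q (fun i => (repr x i)^-1).
have mulV (x : E) : x != 0 -> inv x * x = 1.
  move=> x0; rewrite -{2}(qK x) /inv -rmorphM -(rmorph1 q).
  (* Either the zero set of the representative or its complement belongs to [U]; the first case
     would make [x] zero. *)
  apply/qE; case: (in_ultra_setVsetC [set i | repr x i = 0]%classic ultU) => H.
    case/negP: x0; rewrite -(qK x) -(rmorph0 q); apply/eqP/qE.
    exact: H.
  apply: filterS H => i /= /eqP H.
  by transitivity ((repr x i)^-1 * repr x i) => //; rewrite mulVf.
have inv0 : inv 0 = 0.
  rewrite -[RHS](rmorph0 q); apply/qE.
  have : q (repr (0 : E)) = q 0 by rewrite rmorph0 qK.
  by move/qE; apply: filterS => i /= ->; transitivity ((0 : L i)^-1) => //; rewrite invr0.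
pose Ef : fieldType := HB.pack E (GRing.ComNzRing_isField.Build E mulV inv0).
have Ecl : GRing.closed_field_axiom Ef.
  move=> n a n0.
  have root_at i : exists z : L i,
      z ^+ n = \sum_(k < n) (repr (a k : E) : Pr) i * z ^+ k.
    exact: (@solve_monicpoly (L i) n (fun k => (repr (a k : E) : Pr) i) n0).
  pose z : Pr := fun i => projT1 (cid (root_at i)).
  have zP i : z i ^+ n = _ := projT2 (cid (root_at i)).
  have qsum (m : nat) (c : 'I_m -> Pr) : q (\sum_(k < m) c k) = \sum_(k < m) q (c k).
    exact: rmorph_sum.
  have evsum (m : nat) (c : 'I_m -> Pr) i : (\sum_(k < m) c k) i = \sum_(k < m) c k i.
    elim: m c => [|m IH] c; first by rewrite !big_ord0.
    by rewrite !big_ord_recr /= -(IH (fun k => c (widen_ord (leqnSn m) k))).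
  have evX (f : Pr) k i : (f ^+ k) i = f i ^+ k.
    by elim: k => [|k IH] //; rewrite !exprS -IH.
  exists (q z : Ef); transitivity (q (z ^+ n)); first by rewrite -(rmorphXn q).
  transitivity (q (\sum_(k < n) (repr (a k : E) : Pr) * z ^+ k)).
    apply/qE; apply: filterS filterT => i _ /=.
    by rewrite evX evsum zP; apply: eq_bigr => k _; rewrite -[z i ^+ k](evX z k i).
  rewrite qsum; apply: eq_bigr => k _.
  by rewrite rmorphM rmorphXn qK.
exists (HB.pack_for closedFieldType Ef (Field_isAlgClosed.Build Ef Ecl)), q; split.
- exact: (rmorph1 q).
- by move=> f g; move/qE.
- move=> f g; exact: (rmorphB q (f : Pr) g).
- move=> f g; exact: (rmorphM q (f : Pr) g).
Qed.

(** The indices are finite lists of elements of [K], and the ultrafilter contains every cone of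
    lists that include a given one. Any two elements thus lie in almost every list, where the local
    map respects their difference and product. *)
Lemma closedField_extension (K : fieldType) :
  exists L : closedFieldType, inhabited {rmorphism K -> L}.
Proof.
pose emb (s : seq K) := cid (local_embedding s).
pose L s := projT1 (emb s); pose g s := projT1 (cid (projT2 (emb s))).
have gP s : g s 1 = 1 /\
    {in s &, forall a b, g s (a - b) = g s a - g s b /\ g s (a * b) = g s a * g s b}.
  exact: projT2 (cid (projT2 (emb s))).
pose B : set_system (seq K) :=
  filter_from setT (fun s : seq K => [set t : seq K | {subset s <= t}]%classic).
have FB : ProperFilter B.
  apply: filter_from_proper; last by move=> s _; exists s => a.
  apply: filter_from_filter; first by exists [::].
  move=> s t _ _; exists (s ++ t) => // u /= stu.
  by split=> a sa; apply: stu; rewrite mem_cat sa ?orbT.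
have [U [ultU BU]] := ultraFilterLemma FB.
have [F [q [q1 qE qB qM]]] := ultraproduct_closedField [::] L ultU.
pose h (a : K) := q (fun s => g s a).
have U2 a b : U [set s : seq K | a \in s /\ b \in s]%classic.
  apply: BU; exists [:: a; b] => // s /= abs.
  by split; apply: abs; rewrite !inE eqxx ?orbT.
have hB : {morph h : a b / a - b}.
  move=> a b; rewrite /h -qB; apply: qE.
  by apply: filterS (U2 a b) => s /= [sa sb]; case: ((gP s).2 _ _ sa sb).
have hM : {morph h : a b / a * b}.
  move=> a b; rewrite /h -qM; apply: qE.
  by apply: filterS (U2 a b) => s /= [sa sb]; case: ((gP s).2 _ _ sa sb).
have h1 : h 1 = 1.
  by rewrite -q1; apply: qE; apply: filterS filterT => s _ /=; rewrite (gP s).1.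
exists F; constructor.
exact: (HB.pack h (GRing.isZmodMorphism.Build K F h hB)
                  (GRing.isMonoidMorphism.Build K F h (conj h1 hM))).
Qed.

(** * Triangularization *)

Section Triangularization.
Variable K : fieldType.

Definition upper n (N : 'M[K]_n) := forall i j : 'I_n, (j < i)%N -> N i j = 0.
Definition strictly_upper n (N : 'M[K]_n) :=
  forall i j : 'I_n, (j <= i)%N -> N i j = 0.

Lemma exists_row_notin k n (X : 'M[K]_(k, n)) :
  ~~ row_full X -> exists y : 'rV_n, ~~ (y <= X)%MS.
Proof. by rewrite -sub1mx => /row_subPn [i ?]; exists (row i 1%:M). Qed.

Lemma row_free_col_mx k n (y : 'rV[K]_n) (Q : 'M_(k, n)) :
  row_free Q -> ~~ (y <= Q)%MS -> row_free (col_mx y Q).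
Proof.
move=> freeQ yQ; apply: inj_row_free => v; rewrite -(hsubmxK v) mul_row_col.
set a := lsubmx v; set w := rsubmx v => avw.
have a0 : a = 0.
  apply/eqP; apply: contraNT yQ => a0; have {}a0 : a 0 0 != 0.
    by apply: contraNneq a0 => a0; apply/eqP/matrixP => i j; rewrite !ord1 a0 mxE.
  have -> : y = (a 0 0)^-1 *: - (w *m Q).
    move/eqP: avw; rewrite addr_eq0 => /eqP <-.
    by rewrite [in a *m y](mx11_scalar a) mul_scalar_mx scalerA mulVf ?scale1r.
  by rewrite scalemx_sub // eqmx_opp submxMl.
move: avw; rewrite a0 mul0mx add0r => /eqP; rewrite -(mul0mx _ Q).
by move/eqP/(row_free_inj freeQ) => ->; rewrite row_mx0.
Qed.

Lemma block_upper k (D : K -> Prop) a (c : 'rV[K]_k) (N : 'M_k) :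
  D a -> upper N -> (forall i, D (N i i)) ->
  upper (block_mx (a%:M : 'M_1) c 0 N) /\
  forall i, D ((block_mx (a%:M : 'M_1) c 0 N) i i).
Proof.
move=> Da upN DN; split=> [i j|i].
  case: (split_ordP i) => i' ->; case: (split_ordP j) => j' ->.
  - by rewrite !ord1.
  - by rewrite [i']ord1.
  - by rewrite block_mxEdl mxE.
  - by rewrite block_mxEdr /= ltn_add2l; apply: upN.
case: (split_ordP i) => i' ->; last by rewrite block_mxEdr.
by rewrite block_mxEul [i']ord1 mxE.
Qed.

(* The flag is built upwards from its smallest member: the rows of [Q] below the new one span a stable subspace. *)
Lemma flag_triangularization n (T : 'M[K]_n -> Prop) (D : K -> Prop) :
  (forall k (X : 'M_(k, n)), ~~ row_full X ->
     (forall M, T M -> (X *m M <= X)%MS) ->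
     exists2 y : 'rV_n, ~~ (y <= X)%MS &
       forall M, T M -> exists2 a, D a & (y *m M - a *: y <= X)%MS) ->
  exists2 P, P \in unitmx &
    forall M, T M -> exists N, [/\ upper N, forall i, D (N i i) & P *m M = N *m P].
Proof.
move=> next; suff flag k : (k <= n)%N -> exists2 Q : 'M_(k, n), row_free Q &
    forall M, T M -> exists N, [/\ upper N, forall i, D (N i i) & Q *m M = N *m Q].
  by have [Q] := flag n (leqnn n); rewrite row_free_unit; exists Q.
elim: k => [|k IH] kn.
  exists 0; first by rewrite /row_free mxrank0.
  by move=> M _; exists 0; split=> [[]//|[]//|]; rewrite !mul0mx.
have [Q freeQ QT] := IH (ltnW kn).
have [||y yQ yT] := next _ Q.
- by rewrite /row_full (eqP freeQ) neq_ltn kn.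
- by move=> M /QT [N [_ _ ->]]; rewrite submxMl.
rewrite -add1n; exists (col_mx y Q); first exact: row_free_col_mx.
move=> M TM; have [N [upN DN QM]] := QT M TM.
have [a Da /submxP [c yM]] := yT M TM.
have [upB DB] := block_upper c Da upN DN.
exists (block_mx a%:M c 0 N); split=> //.
by rewrite mul_col_mx mul_block_col mul_scalar_mx -yM mul0mx add0r QM addrC subrK.
Qed.

(** The factors are applied one at a time to a vector that starts outside [X] and ends inside; the
    last vector outside is the answer. The invariant [Z] carries side conditions along. *)
Lemma last_exit k n (Z : 'rV[K]_n.+1 -> Prop) (X : 'M_(k, n.+1)) B (rs : seq K) y :
  (forall y r, r \in rs -> Z y -> Z (y *m (B - r%:M))) ->
  Z y -> ~~ (y <= X)%MS ->
  (y *m horner_mx B (\prod_(r <- rs) ('X - r%:P)) <= X)%MS ->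
  exists y', [/\ Z y', ~~ (y' <= X)%MS & exists2 r, r \in rs & (y' *m (B - r%:M) <= X)%MS].
Proof.
elim: rs y => [|r rs IH] y Zst Zy yX.
  by rewrite big_nil rmorph1 mulmx1 (negbTE yX).
rewrite big_cons rmorphM /= -mulmxE mulmxA rmorphB /= horner_mx_X horner_mx_C => yrs.
case: (boolP (y *m (B - r%:M) <= X)%MS) => yr.
  by exists y; split=> //; exists r; rewrite ?mem_head.
have [||y' [Zy' y'X [r' r'rs y'r']]] := IH _ _ _ yr yrs.
- by move=> z s srs; apply: Zst; rewrite inE srs orbT.
- by apply: Zst; rewrite ?mem_head.
by exists y'; split=> //; exists r'; rewrite // inE r'rs orbT.
Qed.

(** By Cayley-Hamilton the product of the factors kills every vector, so [last_exit] supplies an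
    eigenvector modulo any proper subspace [X]. *)
Lemma char_poly_triangularization n (B : 'M[K]_n.+1) rs :
  char_poly B = \prod_(r <- rs) ('X - r%:P) ->
  exists P N, [/\ P \in unitmx, upper N, forall i, N i i \in rs & P *m B = N *m P].
Proof.
move=> chB; have [|P uP PB] := @flag_triangularization _ (eq B) (fun a => a \in rs).
  move=> k X /exists_row_notin [y yX] _.
  have [||y' [_ y'X [r rrs y'r]]] := @last_exit _ _ (fun=> True) X B rs y _ I yX.
      by [].
    by rewrite -chB Cayley_Hamilton mulmx0 sub0mx.
  by exists y' => // M <-; exists r => //; rewrite -mul_mx_scalar -mulmxBr.
by have [N [upN rsN PBN]] := PB B erefl; exists P, N.
Qed.

Lemma char_poly_similar n (P M N : 'M[K]_n) :
  P \in unitmx -> P *m M = N *m P -> char_poly M = char_poly N.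
Proof.
move=> uP PM; have detP0 : \det (map_mx (@polyC K) P) != 0.
  by rewrite det_map_mx polyC_eq0 -unitfE -unitmxE.
apply: (mulfI detP0); rewrite [RHS]mulrC /char_poly -!det_mulmx /char_poly_mx.
congr (\det _); rewrite mulmxBr mulmxBl -!map_mxM PM.
by rewrite mul_scalar_mx mul_mx_scalar.
Qed.

Lemma char_poly_trmx n (N : 'M[K]_n) : char_poly N^T = char_poly N.
Proof.
by rewrite /char_poly -[in RHS]det_tr /char_poly_mx linearB /= tr_scalar_mx map_trmx.
Qed.

Lemma mxtrace_similar n (P M N : 'M[K]_n) :
  P \in unitmx -> P *m M = N *m P -> \tr M = \tr N.
Proof.
by move=> uP PM; rewrite -[M](mulKmx uP) PM mxtrace_mulC mulmxK.
Qed.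

Lemma char_poly_upper n (N : 'M[K]_n) :
  upper N -> char_poly N = \prod_i ('X - (N i i)%:P).
Proof.
move=> upN; rewrite -char_poly_trmx char_poly_trig; last first.
  by apply/is_trig_mxP => i j ij; rewrite mxE upN.
by apply: eq_bigr => i _; rewrite mxE.
Qed.

Lemma nilpotent_upper n (N : 'M[K]_n) :
  upper N -> char_poly N = 'X^n -> strictly_upper N.
Proof.
move=> upN; rewrite char_poly_upper // => chN i j; rewrite leq_eqVlt.
case/predU1P => [/val_inj ->|]; last exact: upN.
(* At [N i i] the product has a zero factor, so a power of [N i i] vanishes. *)
have /eqP := congr1 (fun p => p.[N i i]) chN.
rewrite horner_prod (bigD1 i) //= !hornerE subrr mul0r eq_sym expf_eq0.
by case/andP=> _ /eqP.
Qed.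

Lemma nilpotent_triangularization n (B : 'M[K]_n.+1) :
  char_poly B = 'X^(n.+1) ->
  exists P N, [/\ P \in unitmx, strictly_upper N & P *m B = N *m P].
Proof.
move=> chB; have [|P [N [uP upN _ PB]]] := @char_poly_triangularization _ B (nseq n.+1 0).
  by rewrite chB big_nseq -Monoid.iteropE subr0.
exists P, N; split=> //; apply: nilpotent_upper => //.
by rewrite -(char_poly_similar uP PB).
Qed.

End Triangularization.

(** * Characteristic polynomials of a rank-one pencil *)

Section OneEigenvalue.
Variable F : fieldType.

Lemma prod_XsubC_one_nonzero (rs : seq F) :
  {in rs &, forall a b, a != 0 -> b != 0 -> a = b} ->
  exists k l, [/\ (k <= size rs)%N,
    \prod_(r <- rs) ('X - r%:P) = 'X^(size rs - k) * ('X - l%:P) ^+ k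
    & \sum_(r <- rs) r = k%:R * l].
Proof.
(* With no nonzero root, [l] defaults to 0 and the count used for [k] is 0. *)
move=> one; pose l := head 0 [seq r <- rs | r != 0].
have rsP r : r \in rs -> r = 0 \/ r = l.
  have [|r0 rrs] := eqVneq r 0; first by left.
  right; have : r \in [seq r <- rs | r != 0] by rewrite mem_filter r0.
  have : {subset [seq r <- rs | r != 0] <= rs} by move=> z; rewrite mem_filter => /andP [].
  have : {in [seq r <- rs | r != 0], forall z, z != 0} by move=> z; rewrite mem_filter => /andP [].
  rewrite /l; case: [seq r <- rs | r != 0] => //= z s nz sub _.
  exact: (one r z rrs (sub _ (mem_head _ _)) r0 (nz _ (mem_head _ _))).
exists (count (predC (pred1 0)) rs), l; move: rsP {one}; move: l => l.
elim: rs => [|r rs IH] rsP; first by rewrite !big_nil !mul0r mulr1.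
have [|le_k prodE sumE] := IH; first by move=> z zrs; apply: rsP; rewrite inE zrs orbT.
rewrite !big_cons prodE sumE /=.
have [r0|r0] := eqVneq r 0.
  by rewrite r0 add0n subSn // leqW // subr0 exprS mulrA add0r.
have [r0'|->] := rsP r (mem_head _ _); first by rewrite r0' eqxx in r0.
rewrite /= add1n subSS ltnS exprS; split=> //; first by rewrite mulrCA.
by rewrite -natr1 mulrDl mul1r addrC.
Qed.

(** The derivative in [Y], taken at [Y = 1], of the homogenization [Y^n p(X / Y)]. *)
Definition euler n (p : {poly F}) := n%:R * p - 'X * p^`().

Lemma eulerD n p q : euler n (p + q) = euler n p + euler n q.
Proof. by rewrite /euler derivD; ring. Qed.

(** One nonzero root is removed, at the price of a scalar that is minus the sum [(k + 1) l] of the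
    roots; the trace tells this sum in advance. *)
Lemma euler_eig n k (l : F) : (k < n)%N ->
  euler n ('X^(n - k.+1) * ('X - l%:P) ^+ k.+1) =
  - (k.+1%:R * l)%:P * ('X^(n - k.+1) * ('X - l%:P) ^+ k).
Proof.
move=> kn; rewrite /euler derivM derivXn deriv_exp derivXsubC mul1r /=.
rewrite -[in n%:R](subnK kn) natrD polyCM polyC_natr; move: (n - k.+1)%N => a.
have -> : 'X * ('X^(a.-1) *+ a * ('X - l%:P) ^+ k.+1 + 'X^a * (('X - l%:P) ^+ k *+ k.+1)) =
    (a%:R : {poly F}) * 'X^a * ('X - l%:P) ^+ k.+1 + k.+1%:R * 'X * 'X^a * ('X - l%:P) ^+ k.
  rewrite mulrDr -[_ *+ a]mulr_natl -[_ *+ k.+1]mulr_natl; congr (_ + _).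
    case: a => [|a] /=; first by rewrite !mul0r mulr0.
    by rewrite (exprS 'X) !mulrA (mulrC 'X).
  have ac (w x v y : {poly F}) : w * (x * (v * y)) = v * w * x * y by ring.
  exact: ac.
rewrite exprS; set x := 'X^a; set y := _ ^+ k; set u := a%:R; set v := k.+1%:R.
move: x y u v l%:P => x y u v z; ring.
Qed.

Lemma euler_Xn n : euler n 'X^n = 0.
Proof.
rewrite /euler derivXn; case: n => [|n]; first by rewrite mulr0n mulr0 mul0r subr0.
by rewrite /= mulrnAr -exprS mulr_natl subrr.
Qed.

(** The products [k l] are the traces 0, 1 and -1. Hence [euler] kills [p0] and removes a nonzero
    root from [p1] and [pm], up to sign; by linearity the two quotients agree, which forces the
    nonzero root of [p1] to be simple. *)
Lemma charpoly_pencil n (p0 p1 pm : {poly F}) k0 k1 km l0 l1 lm :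
  (2%:R != 0 :> F) -> (0 < n)%N ->
  (k0 <= n)%N -> (k1 <= n)%N -> (km <= n)%N ->
  p0 = 'X^(n - k0) * ('X - l0%:P) ^+ k0 -> k0%:R * l0 = 0 ->
  p1 = 'X^(n - k1) * ('X - l1%:P) ^+ k1 -> k1%:R * l1 = 1 ->
  pm = 'X^(n - km) * ('X - lm%:P) ^+ km -> km%:R * lm = -1 ->
  p1 + pm = 2%:R * p0 ->
  p0 = 'X^n /\ p1 = 'X^(n.-1) * ('X - 1).
Proof.
move=> ch2 n0 k0n k1n kmn p0E t0 p1E t1 pmE tm pE.
have eu0 : euler n p0 = 0.
  rewrite p0E; case: k0 k0n t0 {p0E} => [|k0] k0n t0; first by rewrite subn0 mulr1 euler_Xn.
  by rewrite euler_eig // t0 polyC0 oppr0 mul0r.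
case: k1 k1n p1E t1 => [|k1] k1n p1E t1.
  by move/eqP: t1; rewrite mul0r eq_sym oner_eq0.
case: km kmn pmE tm => [|km] kmn pmE tm.
  by move/eqP: tm; rewrite mul0r eq_sym oppr_eq0 oner_eq0.
pose r1 := 'X^(n - k1.+1) * ('X - l1%:P) ^+ k1.
pose rm := 'X^(n - km.+1) * ('X - lm%:P) ^+ km.
have eu1 : euler n p1 = - r1 by rewrite p1E euler_eig // t1 mulN1r.
have eum : euler n pm = rm by rewrite pmE euler_eig // tm polyCN opprK mul1r.
(* Apply [euler] to [p1 + pm = 2 p0]. *)
have rE : r1 = rm.
  apply/eqP; rewrite -subr_eq0 -oppr_eq0 opprB addrC -eu1 -eum.
  by rewrite -eulerD pE mulr_natl mulr2n eulerD eu0 addr0.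
have l10 : l1 != 0.
  by apply: contra_eq_neq t1 => ->; rewrite mulr0 eq_sym oner_eq0.
have p1r : p1 = ('X - l1%:P) * r1 by rewrite p1E exprS mulrCA.
have pmr : pm = ('X - lm%:P) * r1 by rewrite rE pmE exprS mulrCA.
(* Equal roots would give [p1 = pm], hence [r1 = - r1], which characteristic not 2 excludes. *)
have l1m : l1 != lm.
  apply/eqP => l1m; have : 2%:R%:P * r1 = 0.
    have r1N : r1 = - r1 by rewrite {1}rE -eum pmr -l1m -p1r eu1.
    by rewrite polyC_natr mulr_natl mulr2n {1}r1N addNr.
  move/eqP; rewrite mulf_eq0 polyC_eq0 (negbTE ch2) /r1 mulf_eq0 !expf_eq0.
  by rewrite polyX_eq0 polyXsubC_eq0 !andbF.
(* Here [k1] is the exponent minus one; were it positive, [l1] would be a root of [r1] but not of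
   [rm]. *)
have k10 : k1 = 0%N.
  apply/eqP; case: (posnP k1) => // k1_gt0; have := congr1 (horner^~ l1) rE.
  rewrite /r1 /rm !hornerE subrr expr0n (gtn_eqF k1_gt0) mulr0 => /esym/eqP.
  by rewrite mulf_eq0 !expf_eq0 (negbTE l10) subr_eq0 (negbTE l1m) !andbF.
move: t1; rewrite k10 mul1r => l1E.
have r1X : r1 = 'X^(n - 1) by rewrite /r1 k10 mulr1.
pose c := (l1 + lm) / 2%:R.
have p0c : p0 = 'X^(n - 1) * ('X - c%:P) ^+ 1.
  have two0 : (2%:R : {poly F}) != 0 by rewrite -polyC_natr polyC_eq0.
  apply: (mulfI two0); rewrite -pE p1r pmr r1X.
  have cE : c%:P * 2%:R = l1%:P + lm%:P.
    by rewrite -polyC_natr -polyCM divfK // polyCD.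
  transitivity ('X^(n - 1) * (2%:R * 'X - (l1%:P + lm%:P)) : {poly F}); first by ring.
  by rewrite -cE expr1; ring.
(* The only possibly nonzero root of [p0] is [c], and [euler n p0 = 0] forces it to vanish. *)
have c0 : c = 0.
  have := eu0; rewrite p0c euler_eig // mul1r mulr1 => /eqP.
  rewrite mulf_eq0 oppr_eq0 polyC_eq0 expf_eq0 polyX_eq0 andbF orbF.
  by move/eqP.
rewrite p0c p1r r1X l1E c0 subr0 subn1 -exprD addn1 prednK //.
by rewrite mulrC.
Qed.
End OneEigenvalue.

(** A Schur complement: the unit corner clears the block [u]. *)
Lemma det_sub_rank1 (R : comNzRingType) n (S : 'M[R]_n) (u : 'cV_n) (v : 'rV_n) :
  \det (S - u *m v) = \det (block_mx S u v 1%:M).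
Proof.
have -> : block_mx S u v 1%:M = block_mx 1%:M u 0 1%:M *m block_mx (S - u *m v) 0 v 1%:M.
  by rewrite mulmx_block !mul1mx !mul0mx !mulmx1 !add0r subrK.
by rewrite det_mulmx det_ublock det_lblock !det1 !mul1r mulr1.
Qed.

(** In the bordered matrix [v] sits in the last row, in which the determinant is linear; the rows
    [(v, 1)] and [(- v, 1)] add up to [(0, 2)]. *)
Lemma det_rank1_pencil (R : comNzRingType) n (S : 'M[R]_n) (u : 'cV_n) (v : 'rV_n) :
  \det (S - u *m v) + \det (S + u *m v) = 2%:R * \det S.
Proof.
have detN : \det (S + u *m v) = \det (block_mx S u (- v) 1%:M).
  by rewrite -det_sub_rank1 mulmxN opprK.
have det2 : \det S = \det (block_mx S u 0 1%:M) by rewrite det_ublock det1 mulr1.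
pose i0 : 'I_(n + 1) := rshift n ord0.
rewrite det_sub_rank1 detN.
have -> : 2%:R * \det S = \det (block_mx S u 0 2%:R%:M) by rewrite det_ublock det_scalar1 mulrC.
have r' a b c d : row' i0 (block_mx S u a c) = row' i0 (block_mx S u b d) :> 'M_(_, n + 1).
  apply/matrixP => i j; rewrite !mxE; case: splitP => // k ik.
  by case/eqP: (neq_lift i0 i); apply: val_inj; rewrite [RHS]ik ord1.
rewrite (@determinant_multilinear _ _ (block_mx S u 0 2%:R%:M) (block_mx S u v 1%:M)
  (block_mx S u (- v) 1%:M) i0 1 1) ?mul1r //.
rewrite !scale1r /i0 /block_mx !rowKd; apply/rowP => j; rewrite !mxE.
by case: splitP => k _; rewrite !mxE ?subrr // -mulrnDl.
Qed.

Lemma char_poly_eigenvalues (F : closedFieldType) n (M : 'M[F]_n) :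
  exists rs, [/\ size rs = n, char_poly M = \prod_(r <- rs) ('X - r%:P)
    & {in rs, forall r, eigenvalue M r}].
Proof.
have [rs rsE] := closed_field_poly_normal (char_poly M).
rewrite (monicP (char_poly_monic M)) scale1r in rsE; exists rs; split=> //.
  by have := size_char_poly M; rewrite rsE size_prod_XsubC => -[].
by move=> r; rewrite eigenvalue_root_char rsE root_prod_XsubC.
Qed.

Lemma char_poly_one_eigenvalue (F : closedFieldType) n (M : 'M[F]_n) :
  (0 < n)%N ->
  (forall a b, a != 0 -> b != 0 -> eigenvalue M a -> eigenvalue M b -> a = b) ->
  exists k l, [/\ (k <= n)%N, char_poly M = 'X^(n - k) * ('X - l%:P) ^+ k
    & k%:R * l = \tr M].
Proof.
move=> n0 one; have [rs [szrs rsE rs_eig]] := char_poly_eigenvalues M.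
have [|k [l [kn pE sE]]] := @prod_XsubC_one_nonzero F rs.
  by move=> a b ars brs a0 b0; apply: one => //; apply: rs_eig.
rewrite szrs in kn pE; exists k, l; split=> //; first by rewrite rsE pE.
apply: oppr_inj; rewrite -char_poly_trace // rsE -sE -szrs coefPn_prod_XsubC //.
by rewrite szrs -lt0n.
Qed.

(** The eigenvalue hypotheses range over closed fields receiving [K], so one such field must be
    exhibited. There [charpoly_pencil] applies to [M], [M + u v] and [M - u v], of traces 0, 1 and
    -1, and the result descends by injectivity of [map_poly f]. *)
Lemma rank1_pencil_char_poly (K : fieldType) n (M : 'M[K]_n) (u : 'cV_n) (v : 'rV_n) :
  2%:R != 0 :> K -> (0 < n)%N -> \tr M = 0 -> \tr (u *m v) = 1 ->
  at_most_one_nonzero_eigenvalue M ->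
  at_most_one_nonzero_eigenvalue (M + u *m v) ->
  at_most_one_nonzero_eigenvalue (M - u *m v) ->
  char_poly M = 'X^n /\ char_poly (M + u *m v) = 'X^(n.-1) * ('X - 1).
Proof.
move=> ch2 n0 trM trA oneM oneP oneN.
have [L [f]] := closedField_extension K.
have [k0 [l0 [k0n p0E t0]]] := char_poly_one_eigenvalue n0 (oneM L f).
have [k1 [l1 [k1n p1E t1]]] := char_poly_one_eigenvalue n0 (oneP L f).
have [km [lm [kmn pmE tm]]] := char_poly_one_eigenvalue n0 (oneN L f).
have [] := @charpoly_pencil L n _ _ _ k0 k1 km l0 l1 lm _ n0 k0n k1n kmn p0E _ p1E _ pmE.
- by rewrite -(rmorph_nat f) fmorph_eq0.
- by rewrite t0 trace_map_mx trM rmorph0.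
- by rewrite t1 trace_map_mx mxtraceD trM trA add0r rmorph1.
- by rewrite tm trace_map_mx raddfB /= trM trA sub0r rmorphN rmorph1.
- rewrite -!map_char_poly -rmorphD /= -(rmorph_nat (map_poly f)) -rmorphM /=.
  congr (map_poly f _).
  pose u' := map_mx (@polyC K) u; pose v' := map_mx (@polyC K) v.
  have mxP : char_poly_mx (M + u *m v) = char_poly_mx M - u' *m v'.
    by rewrite /char_poly_mx map_mxD map_mxM opprD addrA.
  have mxN : char_poly_mx (M - u *m v) = char_poly_mx M + u' *m v'.
    by rewrite /char_poly_mx map_mxB map_mxM opprB addrCA addrC.
  by rewrite /char_poly mxP mxN det_rank1_pencil.
rewrite -!map_char_poly => p0X p1X; split; apply: (map_poly_inj f).
  by rewrite p0X map_polyXn.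
by rewrite p1X rmorphM /= map_polyXn rmorphB /= map_polyX rmorph1.
Qed.

(** * Trace identities for nilpotent pencils *)

Lemma coef1_prod_1addX (R : comNzRingType) (I : Type) (r : seq I) (c : I -> R) :
  (\prod_(i <- r) (1 + 'X * (c i)%:P))`_0 = 1 /\
  (\prod_(i <- r) (1 + 'X * (c i)%:P))`_1 = \sum_(i <- r) c i.
Proof.
elim: r => [|i r [IH0 IH1]]; first by rewrite !big_nil !coef1.
by rewrite !big_cons mulrDl mul1r -mulrA !coefD !coefXM /= coefCM IH0 IH1 addr0 mulr1 addrC.
Qed.

(** A permutation other than the identity moves at least two indices, so its term is divisible by
    ['X^2]. *)
Lemma coef1_det_1addX (R : comNzRingType) n (C : 'M[R]_n) :
  (\det (1%:M + 'X *: map_mx polyC C))`_1 = \tr C.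
Proof.
rewrite /determinant (bigD1 (1 : 'S_n)%g) //= coefD odd_perm1 expr0 mul1r.
rewrite [X in _ + X](_ : _ = 0) ?addr0.
  rewrite (eq_bigr (fun i => 1 + 'X * (C i i)%:P)) ?(coef1_prod_1addX _ _).2 //.
  by move=> i _; rewrite perm1 !mxE eqxx.
rewrite coef_sum big1 // => s s1.
have [i si] : exists i, s i != i.
  apply/existsP; apply: contraNT s1; rewrite negb_exists => /forallP sid.
  by apply/eqP/permP => i; rewrite perm1; apply/eqP; have := sid i; rewrite negbK.
have ssi : s (s i) != s i by rewrite (inj_eq perm_inj).
rewrite eq_sym in si; rewrite eq_sym in ssi.
rewrite (bigD1 i) //= (bigD1 (s i)) 1?eq_sym //= !mxE.
rewrite (negbTE si) (negbTE ssi) !add0r.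
set c := _%:P; set d := _%:P; set q := \prod_(_ | _) _; set e := (-1) ^+ _.
have -> : e * ('X * c * ('X * d * q)) = 'X * ('X * (e * c * d * q)) by ring.
by rewrite !coefXM.
Qed.

Lemma horner_det_1addX (R : comNzRingType) n (C : 'M[R]_n) p :
  (\det (1%:M + 'X *: map_mx polyC C)).[p] = \det (1%:M + p *: C).
Proof.
rewrite -horner_evalE -det_map_mx map_mxD map_mx1 map_mxZ /= [horner_eval p 'X]hornerX.
congr (\det (_ + _ *: _)).
by apply/matrixP => i j; rewrite !mxE /= [LHS]hornerC.
Qed.

Section TraceIdentities.
Variable K : fieldType.

Lemma det_1addX_nilpotent n (N : 'M[K]_n.+1) :
  char_poly N = 'X^(n.+1) -> \det (1%:M + 'X *: map_mx polyC N) = 1.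
Proof.
case/nilpotent_triangularization => P [T [uP upT PN]].
have detP0 : \det (map_mx (@polyC K) P) != 0.
  by rewrite det_map_mx polyC_eq0 -unitfE -unitmxE.
apply: (mulfI detP0); rewrite -det_mulmx mulmxDr mulmx1 -scalemxAr -map_mxM PN.
rewrite map_mxM scalemxAl -[X in X + _]mul1mx -mulmxDl det_mulmx mulrC; congr (_ * _).
rewrite -det_tr det_trig; last first.
  by apply/is_trig_mxP => i j ij; rewrite !mxE upT 1?ltnW // mulr0 addr0 -val_eqE /= (gtn_eqF ij).
by rewrite big1 // => i _; rewrite !mxE upT // mulr0 addr0 eqxx.
Qed.

(** The odd part of [D] vanishes at [X]: [D_1 + X^2 (D_3 + D_5 X^2 + ...) = 0], where [D_3], [D_5],
    ... are divisible by the inner variable [X]. *)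
Lemma coef1_of_even_at_X (D : {poly {poly K}}) :
  2%:R != 0 :> K -> D.['X] = D.[- 'X] -> (forall i, (1 < i)%N -> root D`_i 0) ->
  exists e, D`_1 = 'X^3 * e.
Proof.
move=> ch2 DX D0; have odd0 : (odd_poly D).['X ^+ 2] = 0.
  move: DX; rewrite -[in X in X -> _](poly_even_odd D) !hornerE !horner_comp !hornerE.
  rewrite sqrrN mulrN => /addrI /eqP; rewrite -addr_eq0 -mulr2n -mulr_natl => /eqP.
  have two0 : (2%:R : {poly K}) != 0 by rewrite -polyC_natr polyC_eq0.
  move/eqP; rewrite mulf_eq0 (negbTE two0) mulf_eq0 polyX_eq0 orbF.
  by move/eqP.
set Q := drop_poly 1 (odd_poly D).
have Q0 : root Q.['X^2] 0.
  rewrite horner_coef rootE -horner_evalE rmorph_sum big1 //= => i _.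
  rewrite horner_evalE hornerM coef_drop_poly coef_odd_poly.
  by rewrite (rootP (D0 _ _)) ?mul0r // ltnS double_gt0 addn1.
have /factor_theorem [e eE] := Q0; exists (- e).
move: odd0; rewrite -(poly_take_drop 1 (odd_poly D)) -/Q hornerD hornerM hornerXn eE.
rewrite subr0 [take_poly 1 _](_ : _ = (D`_1)%:P).
  by rewrite hornerC => /eqP; rewrite addr_eq0 => /eqP ->; rewrite expr1 exprS; ring.
apply/polyP => i; rewrite coef_take_poly coefC coef_odd_poly.
by case: i.
Qed.

(** Let [z] be the inner variable ['X]. As [det (1 + z A) = 1], the polynomial [det (1 + w C)]
    equals [det (1 + z A + w B)]. Its coefficient of [w] is [tr C = tr B - z tr (A B) + z^2 tr (A^2
    B) - ...], which turns out to be divisible by [z^3]. *)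
Lemma nilpotent_pencil_trace n (A B : 'M[K]_n.+1) :
  2%:R != 0 :> K ->
  (forall s t : K, char_poly (s *: A + t *: B) = 'X^(n.+1)) ->
  [/\ \tr B = 0, \tr (A *m B) = 0 & \tr (A *m A *m B) = 0].
Proof.
move=> ch2 nil.
pose a := map_mx (@polyC K) A; pose b := map_mx (@polyC K) B.
have detA : \det (1%:M + 'X *: a) = 1.
  by apply: det_1addX_nilpotent; have := nil 1 0; rewrite scale1r scale0r addr0.
have unitA : 1%:M + 'X *: a \in unitmx by rewrite unitmxE detA unitr1.
pose C := invmx (1%:M + 'X *: a) *m b.
have CE : C = b - 'X *: (a *m C).
  have := mulKVmx unitA b; rewrite -/C mulmxDl mul1mx -scalemxAl => <-.
  by rewrite addrK.
pose D := \det (1%:M + 'X *: map_mx polyC C).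
have detMC p : \det (1%:M + p *: C) = \det (1%:M + 'X *: a + p *: b).
  by rewrite -[LHS]mul1r -[X in X * _]detA -det_mulmx mulmxDr mulmx1 -scalemxAr mulKVmx.
(* Both sides are 1, because [A + B] and [A - B] are nilpotent. *)
have DX : D.['X] = D.[- 'X].
  rewrite !horner_det_1addX !detMC scaleNr -scalerN -!addrA -!scalerDr.
  rewrite -map_mxN -!map_mxD !det_1addX_nilpotent //.
    by have := nil 1 (-1); rewrite scaleN1r scale1r.
  by have := nil 1 1; rewrite !scale1r.
have C0 : map_mx (horner_eval 0) C = B.
  rewrite CE map_mxB map_mxZ /= [horner_eval 0 'X]hornerX scale0r subr0.
  by apply/matrixP => i j; rewrite !mxE /= [LHS]hornerC.
(* At [z = 0] the matrix [C] becomes the nilpotent [B], so [D] reduces to 1. *)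
have D0 i : (0 < i)%N -> root D`_i 0.
  move=> i0; rewrite rootE -horner_evalE -coef_map.
  rewrite -det_map_mx map_mxD map_mx1 map_mxZ /= map_polyX.
  have -> : map_mx (map_poly (horner_eval 0)) (map_mx polyC C) = map_mx (@polyC K) B.
    by apply/matrixP => k l; rewrite -C0 !mxE map_polyC.
  by rewrite det_1addX_nilpotent ?coef1 ?gtn_eqF //; have := nil 0 1; rewrite scale0r scale1r add0r.
have [|e De] := coef1_of_even_at_X ch2 DX; first by move=> i i1; apply/D0/ltnW.
have : \tr C = 'X^3 * e by rewrite -De coef1_det_1addX.
(* The geometric expansion of the inverse, cut at order 3. *)
have CE3 : C = b - 'X *: (a *m b) + 'X^2 *: (a *m a *m b) - 'X^3 *: (a *m a *m a *m C).
  have aC : a *m C = a *m b - 'X *: (a *m a *m C).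
    by rewrite {1}CE mulmxBr -scalemxAr mulmxA.
  have aaC : a *m a *m C = a *m a *m b - 'X *: (a *m a *m a *m C).
    by rewrite {1}CE mulmxBr -scalemxAr mulmxA.
  rewrite {1}CE aC aaC !scalerBr !scalerA ?mulrA.
  have -> : 'X * 'X * 'X = 'X^3 :> {poly K} by ring.
  by rewrite -expr2 opprB [in LHS]addrA [in LHS]addrAC addrA.
rewrite CE3 !(raddfB, raddfD) /= !mxtraceZ -!map_mxM !trace_map_mx.
move=> trE; have trE' : (\tr B)%:P - 'X * (\tr (A *m B))%:P + 'X^2 * (\tr (A *m A *m B))%:P =
   'X^3 * (e + \tr (map_mx polyC (A *m A *m A) *m C)) by rewrite mulrDr -trE; ring.
have coef k : (k < 3)%N -> ((\tr B)%:P - 'X * (\tr (A *m B))%:P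
    + 'X^2 * (\tr (A *m A *m B))%:P)`_k = 0 by move=> k3; rewrite trE' coefXnM k3.
have := coef 0%N isT; have := coef 1%N isT; have := coef 2%N isT.
rewrite !coefD !coefN !coefXM !coefXnM !coefC /= !oppr0 !add0r !addr0 => -> /eqP.
by rewrite oppr_eq0 => /eqP -> ->.
Qed.
End TraceIdentities.

(** * Dimension of totally isotropic spaces *)

Section TraceBound.
Variables (K : fieldType) (n : nat).

Lemma linear_fun_matrix m d (f : 'M[K]_(m, n) -> 'rV_d) : linear f ->
  exists C : 'M_(m * n, d), forall M, mxvec M *m C = f M.
Proof.
move=> flin; pose g v := f (vec_mx v).
have glin : linear g by move=> a u v; rewrite /g linearP flin.
pose G : {linear 'rV_(m * n) -> 'rV_d} := HB.pack g (GRing.isLinear.Build _ _ _ _ g glin).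
by exists (lin1_mx G) => M; rewrite mul_rV_lin1 /= /g mxvecK.
Qed.

Definition lower_pairs := [set p : 'I_n * 'I_n | (p.2 < p.1)%N].
Local Notation d := #|lower_pairs|.

Lemma card_lower_pairs : d = 'C(n, 2).
Proof.
rewrite -bin2_sum big_mkord -sum1_card.
rewrite (eq_bigl (fun p : 'I_n * 'I_n => xpredT p.1 && (p.2 < p.1)%N)); last first.
  by move=> p; rewrite inE.
rewrite -(pair_big_dep xpredT (fun i j : 'I_n => (j < i)%N) (fun _ _ => 1%N)) /=.
apply: eq_bigr => i _.
by rewrite (big_ord_narrow (ltnW (ltn_ord i))) /= sum1_card card_ord.
Qed.

Definition low_part (M : 'M[K]_n) : 'rV[K]_d :=
  \row_k M (enum_val k).1 (enum_val k).2.
(** Sharing the index set of [low_part] turns the trace pairing into a dot product. *)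
Definition up_part (M : 'M[K]_n) : 'rV[K]_d := low_part M^T.

Lemma low_part_linear : linear low_part.
Proof. by move=> a M N; apply/rowP => k; rewrite !mxE. Qed.
Lemma up_part_linear : linear up_part.
Proof. by move=> a M N; apply/rowP => k; rewrite !mxE. Qed.

Lemma low_part_eq0 M : low_part M = 0 <-> upper M.
Proof.
split=> [M0 i j ij|upM]; last first.
  by apply/rowP => k; rewrite !mxE upM //; have := enum_valP k; rewrite inE.
have ijD : (i, j) \in lower_pairs by rewrite inE.
have := congr1 (fun r : 'rV_d => r 0 (enum_rank_in ijD (i, j))) M0.
by rewrite !mxE enum_rankK_in.
Qed.

Lemma up_part_inj M N :
  strictly_upper M -> strictly_upper N -> up_part M = up_part N -> M = N.
Proof.
move=> supM supN eqMN; apply/matrixP => i j.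
have [ji|ij] := leqP j i; first by rewrite supM ?supN.
have ijD : (j, i) \in lower_pairs by rewrite inE.
have := congr1 (fun r : 'rV_d => r 0 (enum_rank_in ijD (j, i))) eqMN.
by rewrite !mxE enum_rankK_in.
Qed.

Lemma rank_up_part m (S : 'M[K]_(m, n * n)) (C : 'M_(n * n, d)) :
  (forall M, (M \in S)%MS -> strictly_upper M) ->
  (forall M, mxvec M *m C = up_part M) -> \rank (S *m C) = \rank S.
Proof.
move=> supS CE; rewrite -[RHS](mxrank_mul_ker S C).
suff -> : \rank (S :&: kermx C) = 0%N by rewrite addn0.
apply/eqP; rewrite mxrank_eq0; apply/eqP/row_matrixP => i; rewrite row0.
have : (row i (S :&: kermx C)%MS <= S :&: kermx C)%MS by apply: row_sub.
set r := row i _; rewrite -[r]vec_mxK sub_capmx => /andP [/supS supM /sub_kermxP].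
rewrite CE => up0; rewrite (up_part_inj supM (N := 0)) ?linear0 //.
  by move=> ? ?; rewrite mxE.
by rewrite up0; apply/rowP => k; rewrite !mxE.
Qed.

Lemma mxtrace_strictly_upper X Y : strictly_upper X ->
  \tr (X *m Y) = (up_part X *m (low_part Y)^T) 0 0.
Proof.
move=> supX; rewrite /mxtrace mxE.
under eq_bigr => i _ do rewrite mxE.
rewrite pair_big /= (bigID (fun p : 'I_n * 'I_n => (p.1 < p.2)%N)) /=.
rewrite [X in _ + X]big1 ?addr0; last first.
  by move=> p; rewrite -leqNgt => p21; rewrite supX ?mul0r.
pose swap (p : 'I_n * 'I_n) := (p.2, p.1).
have swapK : involutive swap by case.
rewrite (reindex_inj (inv_inj swapK)) /=.
transitivity (\sum_(p in lower_pairs) X p.2 p.1 * Y p.1 p.2).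
  by apply: eq_bigl => p; rewrite inE.
rewrite big_enum_val /=.
by apply: eq_bigr => k _; rewrite !mxE.
Qed.

(** Rank-nullity for [low_part] splits the rank of [V] into that of its lower parts and that of its
    upper triangular members, which [up_part] embeds. Isotropy makes the two images orthogonal in
    [K^d], so their ranks sum to at most [d]. *)
Lemma trace_isotropic_bound m (V : 'M[K]_(m, n * n)) :
  (forall M, (M \in V)%MS -> upper M -> strictly_upper M) ->
  (forall X Y, (X \in V)%MS -> (Y \in V)%MS -> \tr (X *m Y) = 0) ->
  (\rank V <= 'C(n, 2))%N.
Proof.
move=> Vup Vtr.
have [Cl ClE] := linear_fun_matrix low_part_linear.
have [Cu CuE] := linear_fun_matrix up_part_linear.
pose S := (V :&: kermx Cl)%MS.
have SP M : (M \in S)%MS -> (M \in V)%MS /\ strictly_upper M.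
  rewrite sub_capmx => /andP [MV /sub_kermxP]; rewrite ClE => /low_part_eq0 upM.
  by split=> //; apply: Vup.
rewrite -(mxrank_mul_ker V Cl) -/S -(rank_up_part (fun M MS => (SP M MS).2) CuE).
rewrite -card_lower_pairs -[X in (_ + X)%N]mxrank_tr; apply: mulmx0_rank_max.
apply/matrixP => i j; rewrite [RHS]mxE.
pose Y := vec_mx (row i V); pose X := vec_mx (row j S).
have [XV supX] : (X \in V)%MS /\ strictly_upper X by apply: SP; rewrite vec_mxK row_sub.
have <- : \tr (X *m Y) = 0 by apply: Vtr; rewrite // vec_mxK row_sub.
rewrite (mxtrace_strictly_upper _ supX) -CuE -ClE !vec_mxK -!row_mul !mxE.
by apply: eq_bigr => k _; rewrite !mxE mulrC.
Qed.
End TraceBound.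

(** * Jordan-closed spaces of nilpotent matrices *)

Section MatrixSpaces.
Variables (K : fieldType).

(** By injectivity and the dimension, [up_part] maps [V] onto all of [K^d]. *)
Lemma strictly_upper_full n m (V : 'M[K]_(m, n * n)) :
  (forall M, (M \in V)%MS -> strictly_upper M) -> \rank V = 'C(n, 2) ->
  forall N, strictly_upper N -> (N \in V)%MS.
Proof.
move=> supV rkV N supN.
have [C CE] := linear_fun_matrix (@up_part_linear K n).
have full : row_full (V *m C).
  by rewrite /row_full (rank_up_part supV CE) rkV card_lower_pairs.
have /submxP [D DE] : (up_part N <= V *m C)%MS by apply: submx_full.
have DV : (vec_mx (D *m V) \in V)%MS by rewrite vec_mxK submxMl.
rewrite (up_part_inj supN (supV _ DV)) // DE mulmxA -[D *m V in LHS]vec_mxK.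
by rewrite CE.
Qed.

Lemma conj_space n m (P : 'M[K]_n) (V : 'M[K]_(m, n * n)) : P \in unitmx ->
  exists2 V' : 'M[K]_(m, n * n), \rank V' = \rank V &
    forall M, (M \in V')%MS = (invmx P *m M *m P \in V)%MS.
Proof.
move=> uP.
have conj_lin (Q R : 'M[K]_n) : linear (fun M : 'M_n => mxvec (Q *m M *m R)).
  by move=> a M N; rewrite mulmxDr mulmxDl -scalemxAr -scalemxAl linearP.
have [C CE] := linear_fun_matrix (conj_lin P (invmx P)).
have [C' C'E] := linear_fun_matrix (conj_lin (invmx P) P).
have CK : C *m C' = 1%:M.
  apply/row_matrixP => i; rewrite rowE mulmxA -[delta_mx 0 i]vec_mxK CE C'E.
  by rewrite !mulmxA mulmxKV // mulVmx // mul1mx vec_mxK rowE mulmx1.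
have freeC : row_free C by apply/row_freeP; exists C'.
exists (V *m C); first by rewrite mxrankMfree.
move=> M; rewrite -[RHS](submxMfree _ _ freeC) CE.
by rewrite !mulmxA mulmxV // mul1mx mulmxK.
Qed.

Definition strictly_triangularizable n m (T : 'M[K]_(m, n * n)) :=
  exists2 P : 'M[K]_n, P \in unitmx &
    forall M, (M \in T)%MS -> exists2 N, strictly_upper N & P *m M = N *m P.

(** Each row of [P] is sent into the span of the later rows, so the last row outside [X] works. *)
Lemma strictly_triangularizable_exit n m (T : 'M[K]_(m, n * n)) :
  strictly_triangularizable T ->
  forall k (X : 'M_(k, n)), ~~ row_full X ->
  exists2 y : 'rV_n, ~~ (y <= X)%MS & forall M, (M \in T)%MS -> (y *m M <= X)%MS.
Proof.
case=> P uP PT k X nfX.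
have /row_subPn [i0 i0X] : ~~ (P <= X)%MS.
  by apply: contra nfX => PX; rewrite -sub1mx (submx_trans _ PX) // sub1mx row_full_unit.
case: (@arg_maxnP _ i0 (fun i => ~~ (row i P <= X)%MS) (@nat_of_ord n) i0X) => i iX imax.
exists (row i P) => // M /PT [N supN PM].
rewrite -row_mul PM row_mul mulmx_sum_row summx_sub // => j _; rewrite mxE.
have [ji|ij] := leqP j i; first by rewrite supN // scale0r sub0mx.
by rewrite scalemx_sub //; apply: contraLR ij => jX; rewrite -leqNgt; apply: imax.
Qed.

Lemma exit_strictly_triangularizable n m (T : 'M[K]_(m, n * n)) :
  (forall k (X : 'M_(k, n)), ~~ row_full X ->
     (forall M, (M \in T)%MS -> (X *m M <= X)%MS) ->
     exists2 y : 'rV_n, ~~ (y <= X)%MS & forall M, (M \in T)%MS -> (y *m M <= X)%MS) ->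
  strictly_triangularizable T.
Proof.
move=> exitT.
have [|P uP PT] := @flag_triangularization K n (fun M => (M \in T)%MS) (eq 0).
  move=> k X nfX XT; have [y yX yT] := exitT k X nfX XT.
  by exists y => // M MT; exists 0; rewrite // scale0r subr0 yT.
exists P => // M /PT [N [upN N0 PM]]; exists N => // i j.
rewrite leq_eqVlt => /predU1P [/val_inj ->|]; last exact: upN.
by rewrite -N0.
Qed.

Lemma mem_adds_mxvec n m (T : 'M[K]_(m, n * n)) (B M : 'M[K]_n) :
  (M \in T + mxvec B)%MS -> exists c N, (N \in T)%MS /\ M = N + c *: B.
Proof.
case/sub_addsmxP => [[u w]] /= E; exists (w 0 0), (vec_mx (u *m T)).
rewrite vec_mxK submxMl; split=> //.
rewrite -[M]mxvecK E [w]mx11_scalar mul_scalar_mx linearD linearZ /= mxvecK.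
by rewrite mxE eqxx mulr1n.
Qed.

(** The vectors that [T] sends into [X] are preserved by [B], because
    [z B t = z (B t + t B) - z t B]. As [B] is nilpotent, [last_exit] finds one outside [X] that [B]
    sends into [X] too. *)
Lemma strictly_triangularizable_adds n m (T : 'M[K]_(m, n.+1 * n.+1)) B :
  strictly_triangularizable T -> char_poly B = 'X^(n.+1) ->
  (forall t, (t \in T)%MS -> (B *m t + t *m B \in T)%MS) ->
  strictly_triangularizable (T + mxvec B)%MS.
Proof.
move=> triT chB BT; apply: exit_strictly_triangularizable => k X nfX XT.
have [y yX yT] := strictly_triangularizable_exit triT nfX.
have XB : (X *m B <= X)%MS by apply: XT; apply: addsmxSr.
pose Z (z : 'rV_n.+1) := forall t, (t \in T)%MS -> (z *m t <= X)%MS.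
have [||y' [Zy' y'X [r rE y'B]]] := @last_exit K k n Z X B (nseq n.+1 0) y _ yT yX.
- move=> z r; rewrite mem_nseq => /eqP -> Zz t tT; rewrite raddf0 subr0.
  have -> : z *m B *m t = z *m (B *m t + t *m B) - z *m t *m B.
    by rewrite mulmxDr !mulmxA addrK.
  apply: addmx_sub; first by apply/Zz/BT.
  rewrite eqmx_opp; exact: submx_trans (submxMr B (Zz t tT)) XB.
- have -> : \prod_(r <- nseq n.+1 0) ('X - r%:P) = char_poly B.
    by rewrite chB big_nseq -Monoid.iteropE subr0.
  by rewrite Cayley_Hamilton mulmx0 sub0mx.
move: rE y'B; rewrite mem_nseq => /eqP ->; rewrite raddf0 subr0 => y'B.
exists y' => // M /mem_adds_mxvec [c [N [NT ->]]].
rewrite mulmxDr; apply: addmx_sub; first exact: Zy'.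
by rewrite -scalemxAr scalemx_sub.
Qed.

(* [band k] keeps the entries with [j - i >= k - n]; the offset [n] keeps [k] a natural number, so that [band 0] is everything and [band (2 n)] only [0]. *)
Definition band n k (M : 'M[K]_n) :=
  forall i j : 'I_n, (j + n < i + k)%N -> M i j = 0.

Lemma band_mul_strictly_upper n k (M N : 'M[K]_n) :
  band k M -> strictly_upper N -> band k.+1 (M *m N) /\ band k.+1 (N *m M).
Proof.
move=> bM supN; split=> i j; rewrite addnS ltnS => ij; rewrite mxE big1 // => l _.
  have [jl|lj] := leqP j l; first by rewrite (supN l j) // mulr0.
  rewrite bM ?mul0r //; apply: leq_trans ij; by rewrite ltn_add2r.
have [li|il] := leqP l i; first by rewrite (supN i l) // mul0r.
by rewrite bM ?mulr0 //; apply: leq_ltn_trans ij _; rewrite ltn_add2r.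
Qed.

(* Take [B] outside [T] as high as possible in the band filtration: [M |-> M t + t M] raises the band. *)
Lemma exists_jordan_normalizer n m m' (V : 'M[K]_(m, n * n)) (T : 'M[K]_(m', n * n)) :
  (forall M N, (M \in V)%MS -> (N \in V)%MS -> (M *m N + N *m M \in V)%MS) ->
  strictly_triangularizable T -> (T <= V)%MS -> ~~ (V <= T)%MS ->
  exists B, [/\ (B \in V)%MS, ~~ (B \in T)%MS
    & forall t, (t \in T)%MS -> (B *m t + t *m B \in T)%MS].
Proof.
move=> jordV [P uP PT] TV VT; apply: contrapT => noB; case/negP: VT.
suff inT e B : (e <= n + n)%N -> (B \in V)%MS ->
    band (n + n - e) (P *m B *m invmx P) -> (B \in T)%MS.
  apply/row_subP => i; rewrite -[row i V]vec_mxK.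
  apply: (inT (n + n)%N); rewrite ?vec_mxK ?row_sub // => k l.
  by rewrite subnn addn0 ltnNge (leq_trans (ltnW (ltn_ord k))) ?leq_addl.
elim: e B => [|e IH] B le_e BV bB.
  have PB0 : P *m B *m invmx P = 0.
    apply/matrixP => i j; rewrite [RHS]mxE bB // subn0 addnA ltn_add2r.
    by rewrite (leq_trans (ltn_ord j)) ?leq_addl.
  have -> : B = 0 by rewrite -[B](mulKmx uP) -[P *m B](mulmxKV uP) PB0 mul0mx mulmx0.
  by rewrite linear0 sub0mx.
(* The brackets of [B] with [T] lie one band higher, hence in [T] by induction, so a [B] outside [T]
   would be the excluded normalizer. *)
apply: contrapT => /negP BT; apply: noB; exists B; split=> // t tT.
have [N supN PtN] := PT t tT.
apply: IH; rewrite ?(ltnW le_e) ?jordV //; first exact: submx_trans tT TV.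
have -> : P *m (B *m t + t *m B) *m invmx P =
    (P *m B *m invmx P) *m N + N *m (P *m B *m invmx P).
  have NE : N = P *m t *m invmx P by rewrite PtN mulmxK.
  by rewrite mulmxDr mulmxDl NE !mulmxA !mulmxKV.
have [b1 b2] := band_mul_strictly_upper bB supN.
rewrite -subSn // subSS in b1 b2.
by move=> i j ij; rewrite mxE b1 ?b2 ?addr0.
Qed.

(** Starting from 0, normalizing elements of [V] are adjoined to a triangularizable subspace until
    it fills [V]. *)
Lemma jordan_nil_strictly_triangularizable n m (V : 'M[K]_(m, n.+1 * n.+1)) :
  (forall M, (M \in V)%MS -> char_poly M = 'X^(n.+1)) ->
  (forall M N, (M \in V)%MS -> (N \in V)%MS -> (M *m N + N *m M \in V)%MS) ->
  strictly_triangularizable V.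
Proof.
move=> nilV jordV.
suff grow e m' (T : 'M_(m', n.+1 * n.+1)) : strictly_triangularizable T ->
    (T <= V)%MS -> (\rank V - \rank T <= e)%N -> strictly_triangularizable V.
  apply: (grow (\rank V) 1%N 0); rewrite ?sub0mx ?leq_subr //.
  exists 1%:M; first exact: unitmx1.
  move=> M /submx0null/eqP; rewrite mxvec_eq0 => /eqP ->; exists 0; last by rewrite mulmx0 mul0mx.
  by move=> i j; rewrite mxE.
have sub_tri r (S : 'M_(r, n.+1 * n.+1)) :
    (V <= S)%MS -> strictly_triangularizable S -> strictly_triangularizable V.
  by move=> VS [P uP PS]; exists P => // M MV; apply/PS/(submx_trans MV).
elim: e m' T => [|e IH] k T triT TV rk.
  apply: (sub_tri _ T) => //; rewrite -(mxrank_leqif_sup TV).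
  by rewrite eqn_leq mxrankS //= -subn_eq0 -leqn0.
have [VT|VT] := boolP (V <= T)%MS; first exact: (sub_tri _ T).
have [B [BV BT BTT]] := exists_jordan_normalizer jordV triT TV VT.
apply: (IH _ (T + mxvec B)%MS).
- exact: strictly_triangularizable_adds (nilV _ BV) BTT.
- by rewrite addsmx_sub TV.
have : (T < T + mxvec B)%MS.
  by rewrite ltmxE addsmxSl; apply: contra BT; apply: submx_trans; apply: addsmxSr.
move/rank_ltmx => rkT; rewrite leq_subLR (leq_trans _ (leq_add rkT (leqnn e))) //.
by rewrite addSnnS -leq_subLR.
Qed.

End MatrixSpaces.

(** * Nilpotent spaces of maximal dimension *)

Section NilpotentSpaces.
Variables (K : fieldType) (n m : nat) (V : 'M[K]_(m, n.+1 * n.+1)).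
Hypothesis two_neq0 : 2%:R != 0 :> K.
Hypothesis nilV : forall M, (M \in V)%MS -> char_poly M = 'X^(n.+1).

Lemma mxtrace_strictly_upper0 (N : 'M[K]_n.+1) : strictly_upper N -> \tr N = 0.
Proof. by move=> supN; rewrite /mxtrace big1 // => i _; rewrite supN. Qed.

Lemma strictly_upper_mul k (M N : 'M[K]_k) :
  strictly_upper M -> strictly_upper N -> strictly_upper (M *m N).
Proof.
move=> supM supN i j ji; rewrite mxE big1 // => l _.
have [li|il] := leqP l i; first by rewrite supM ?mul0r.
by rewrite supN ?mulr0 // (leq_trans ji) // ltnW.
Qed.

Lemma nil_space_trace A B : (A \in V)%MS -> (B \in V)%MS ->
  \tr (A *m B) = 0 /\ \tr (A *m A *m B) = 0.
Proof.
move=> AV BV; have [|_ ->] // := @nilpotent_pencil_trace K n A B two_neq0.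
by move=> s t; apply: nilV; rewrite linearD !linearZ addmx_sub ?scalemx_sub.
Qed.

(** Gerstenhaber's bound, obtained from isotropy for the trace form. *)
Lemma nil_space_rank : (\rank V <= 'C(n.+1, 2))%N.
Proof.
apply: trace_isotropic_bound => [M MV upM|X Y XV YV]; last by case: (nil_space_trace XV YV).
exact/nilpotent_upper/nilV.
Qed.

(* Adjoining [A^2] keeps the space totally isotropic for the trace form, and in a basis where [A] is strictly upper triangular it keeps its upper triangular elements strictly so; maximality of the dimension then puts [A^2] in the space. *)
Lemma nil_space_sqr A : \rank V = 'C(n.+1, 2) -> (A \in V)%MS -> (A *m A \in V)%MS.
Proof.
move=> rkV AV; have [P [N [uP supN PA]]] := nilpotent_triangularization (nilV AV).
have PAA : P *m (A *m A) = N *m N *m P by rewrite mulmxA PA -[LHS]mulmxA PA mulmxA.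
have supNN : strictly_upper (N *m N) by apply: strictly_upper_mul.
have trA4 : \tr (A *m A *m (A *m A)) = 0.
  rewrite (@mxtrace_similar K _ P _ (N *m N *m (N *m N)) uP) ?mxtrace_strictly_upper0 //.
    exact: strictly_upper_mul.
  by rewrite mulmxA PAA -[LHS]mulmxA PAA !mulmxA.
pose W := (V + mxvec (A *m A))%MS.
have [W' rkW' W'E] := conj_space W uP.
suff rkW : (\rank W <= \rank V)%N.
  have : (W <= V)%MS.
    by rewrite -(mxrank_leqif_sup (addsmxSl V _)) eqn_leq rkW mxrankS ?addsmxSl.
  by apply: submx_trans; apply: addsmxSr.
rewrite rkV -rkW'; apply: trace_isotropic_bound => [M|X Y].
  rewrite W'E => /mem_adds_mxvec [c [B [BV PMP]]] upM.
  have ME : M *m P = P *m B + c *: (N *m N *m P).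
    by rewrite -PAA scalemxAr -mulmxDr -PMP !mulmxA mulmxV ?mul1mx.
  have PB : P *m B = (M - c *: (N *m N)) *m P.
    by rewrite mulmxBl ME -scalemxAl addrK.
  have entryE (i j : 'I_n.+1) : (j <= i)%N -> (M - c *: (N *m N)) i j = M i j.
    by move=> ji; rewrite mxE [X in _ + X]mxE [X in _ - X]mxE supNN // mulr0 subr0.
  (* This matrix is the conjugate of [B], hence nilpotent, and it is upper triangular because it
     differs from [M] by a strictly upper one. *)
  have supB : strictly_upper (M - c *: (N *m N)).
    apply: nilpotent_upper; last by rewrite -(char_poly_similar uP PB) nilV.
    by move=> i j ji; rewrite entryE ?upM // ltnW.
  by move=> i j ji; rewrite -entryE ?supB.
rewrite !W'E => /mem_adds_mxvec [c [B [BV XE]]] /mem_adds_mxvec [d [C [CV YE]]].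
have -> : \tr (X *m Y) = \tr ((B + c *: (A *m A)) *m (C + d *: (A *m A))).
  rewrite -XE -YE; apply/esym/(@mxtrace_similar K _ P) => //.
  by rewrite !mulmxA mulmxV // mul1mx mulmxK.
(* The cross terms vanish by the identity [tr (A^2 B) = 0], the last term by [tr (A^4) = 0]. *)
rewrite mulmxDl !mulmxDr !linearD /= -!scalemxAl -!scalemxAr !linearZ /= trA4.
rewrite (nil_space_trace BV CV).1 (nil_space_trace AV CV).2.
by rewrite mxtrace_mulC (nil_space_trace AV BV).2 !mulr0 !addr0.
Qed.

(** Polarization of the closure under squares. *)
Lemma nil_space_jordan : \rank V = 'C(n.+1, 2) ->
  forall M N, (M \in V)%MS -> (N \in V)%MS -> (M *m N + N *m M \in V)%MS.
Proof.
move=> rkV M N MV NV; have sq := nil_space_sqr rkV.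
have MNV : (M + N \in V)%MS by rewrite linearD addmx_sub.
have -> : M *m N + N *m M = (M + N) *m (M + N) - M *m M - N *m N.
  rewrite mulmxDl !mulmxDr addrA [RHS]addrAC addrK.
  by rewrite [RHS]addrC !addrA addNr add0r.
by rewrite !linearB /= !addmx_sub ?eqmx_opp ?sq.
Qed.

Lemma nil_space_conj : \rank V = 'C(n.+1, 2) ->
  exists2 P, P \in unitmx &
    forall N, (invmx P *m N *m P \in V)%MS <-> strictly_upper N.
Proof.
move=> rkV.
have [P uP PV] := jordan_nil_strictly_triangularizable nilV (nil_space_jordan rkV).
have [V' rkV' V'E] := conj_space V uP; exists P => // N; rewrite -V'E.
have supV' M : (M \in V')%MS -> strictly_upper M.
  rewrite V'E => /PV [N' supN']; rewrite !mulmxA mulmxV // mul1mx => MP.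
  by rewrite -[M](mulmxK uP) MP mulmxK.
split=> [/supV' //|]; apply: strictly_upper_full => //; by rewrite rkV'.
Qed.

End NilpotentSpaces.

(** * Rank-one matrices and the final change of basis *)

Lemma colspace_rank1 (K : fieldType) n (u : 'cV[K]_n) (w : 'rV_n) :
  w != 0 -> colspace_is (u *m w) u.
Proof.
move=> /rV0Pn [k wk]; rewrite /colspace_is trmx_mul submxMl /=.
have uE : u^T = (w 0 k)^-1 *: row k (w^T *m u^T).
  by apply/rowP => j; rewrite !mxE big_ord1 !mxE mulrA mulVf ?mul1r.
by rewrite {1}uE scalemx_sub ?row_sub.
Qed.

Lemma colspace_isP (K : fieldType) n (M : 'M[K]_n) (u : 'cV[K]_n) :
  colspace_is M u -> exists w, M = u *m w.
Proof.
case/andP=> /submxP [D DE] _; exists D^T.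
by rewrite -[M]trmxK DE trmx_mul trmxK.
Qed.

(** All eigenvalues are 0 or 1, so squaring leaves the diagonal of a triangular form unchanged. *)
Lemma mxtrace_sqr_idem_spectrum (K : fieldType) n (B : 'M[K]_n.+1) :
  char_poly B = 'X^n * ('X - 1) -> \tr (B *m B) = \tr B.
Proof.
move=> chB; have [|P [N [uP upN Nrs PB]]] := @char_poly_triangularization K n B (1 :: nseq n 0).
  by rewrite chB big_cons big_nseq -Monoid.iteropE subr0 mulrC.
have PBB : P *m (B *m B) = N *m N *m P by rewrite mulmxA PB -[LHS]mulmxA PB mulmxA.
rewrite (mxtrace_similar uP PB) (mxtrace_similar uP PBB).
apply: eq_bigr => i _; rewrite mxE (bigD1 i) //= big1 => [|j ji].
  have := Nrs i; rewrite inE mem_nseq addr0.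
  by case/orP => [/eqP ->|/andP [_ /eqP ->]]; rewrite ?mulr1 ?mulr0.
have [lt|gt|/val_inj E] := ltngtP i j; last by rewrite E eqxx in ji.
  by rewrite (upN j i) ?mulr0.
by rewrite (upN i j) ?mul0r.
Qed.

Lemma mxtrace_delta_mul (K : fieldType) n (A : 'M[K]_n) i j :
  \tr (delta_mx j i *m A) = A i j.
Proof.
rewrite -(mul_delta_mx (0 : 'I_1)) -mulmxA mxtrace_mulC -mulmxA.
by rewrite mulmxA -rowE -colE /mxtrace big_ord1 !mxE.
Qed.

Theorem mainTheorem13 (K : fieldType) (n : nat) (V : 'A[K]_n) :
  2 \notin [pchar K] ->
  (2 <= n)%N ->
  \rank V = ('C(n, 2) + 1)%N ->
  (forall M : 'M[K]_n, (M \in V)%MS -> at_most_one_nonzero_eigenvalue M) ->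
  (exists x : 'cV[K]_n, good V x /\
     exists A : 'M[K]_n, (A \in V)%MS /\ colspace_is A x) ->
  exists P : 'M[K]_n, P \in unitmx /\
    forall M : 'M[K]_n, (M \in V)%MS <-> En_NT (P *m M *m invmx P).
Proof.
move=> ch2 n2 rkV oneV [u [[u0 goodu] [A [AV /[dup] colA /colspace_isP [w AE]]]]].
have two0 : 2%:R != 0 :> K by apply: contra ch2 => two0; rewrite inE.
case: n n2 V rkV oneV u A w AE u0 goodu AV colA => // n _ V rkV oneV u A w AE u0 goodu AV colA.
have trA : \tr A != 0 by apply/eqP => trA; apply: goodu; exists A.
pose v := (\tr A)^-1 *: w; pose A1 := u *m v.
have A1V : (A1 \in V)%MS by rewrite /A1 -scalemxAr -AE linearZ scalemx_sub.
have trA1 : \tr A1 = 1 by rewrite /A1 -scalemxAr -AE mxtraceZ mulVf.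
have trlin : linear (fun M : 'M[K]_n.+1 => (\tr M)%:M : 'rV_1).
  by move=> a M N; apply/rowP => i; rewrite linearP !ord1 !mxE !mulr1n.
have [C CE] := linear_fun_matrix trlin.
pose V0 := (V :&: kermx C)%MS.
have V0P M : (M \in V0)%MS <-> (M \in V)%MS /\ \tr M = 0.
  rewrite sub_capmx; split=> [/andP [-> /sub_kermxP]|[-> trM]].
    by rewrite CE => /(congr1 (fun r : 'rV_1 => r 0 0)); rewrite !mxE mulr1n.
  by apply/sub_kermxP; rewrite CE trM raddf0.
have rk1 M : (M \in V0)%MS ->
    char_poly M = 'X^(n.+1) /\ char_poly (M + A1) = 'X^n * ('X - 1).
  case/V0P=> MV trM; apply: rank1_pencil_char_poly => //; apply: oneV => //.
    by rewrite linearD addmx_sub.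
  by rewrite linearB addmx_sub // eqmx_opp.
have nilV0 M : (M \in V0)%MS -> char_poly M = 'X^(n.+1) by move=> /rk1 [].
(* The trace is a single linear condition and costs at most one dimension; [nil_space_rank] gives
   the other inequality. *)
have rkV0 : \rank V0 = 'C(n.+1, 2).
  apply/eqP; rewrite eqn_leq nil_space_rank //=.
  by rewrite -(leq_add2r 1) -rkV -(mxrank_mul_ker V C) addnC leq_add2l rank_leq_col.
(* Expand [tr ((M + A1)^2) = tr (M + A1) = 1]: since [tr (M^2) = 0] and [tr (A1^2) = 1], what
   remains is [2 tr (M A1) = 0]. *)
have trMA1 M : (M \in V0)%MS -> \tr (M *m A1) = 0.
  move=> MV0; have [_ /mxtrace_sqr_idem_spectrum] := rk1 M MV0.
  have [_ trM] := (V0P M).1 MV0.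
  have sqrA1 : \tr (A1 *m A1) = 1.
    have [|_] := rk1 0; first by rewrite linear0 sub0mx.
    by rewrite add0r => /mxtrace_sqr_idem_spectrum ->.
  rewrite mulmxDl !mulmxDr !linearD /= (nil_space_trace two0 nilV0 MV0 MV0).1 sqrA1.
  rewrite trM trA1 (mxtrace_mulC A1) !add0r addrA -[RHS]add0r => /addIr.
  by rewrite -mulr2n -mulr_natl => /eqP; rewrite mulf_eq0 (negbTE two0) => /eqP.
have [P uP PV0] := nil_space_conj two0 nilV0 rkV0.
have conjK N : invmx P *m (P *m N *m invmx P) *m P = N.
  by rewrite !mulmxA mulVmx // mul1mx mulmxKV.
pose u' := P *m u; pose v' := v *m invmx P.
pose A' := P *m A1 *m invmx P.
have A'E : A' = u' *m v' by rewrite /A' /A1 /u' /v' !mulmxA.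
have A'ij i j : A' i j = u' i 0 * v' 0 j by rewrite A'E mxE big_ord1.
(* The entry [(i, j)] is a trace against the matrix unit at [(j, i)], which is strictly upper
   triangular when [j < i]. *)
have upA' : upper A'.
  move=> i j ji; rewrite -mxtrace_delta_mul.
  have dV0 : (invmx P *m delta_mx j i *m P \in V0)%MS.
    apply/PV0 => k l lk; rewrite mxE; case: andP => // -[/eqP kj /eqP li].
    by move: lk; rewrite kj li leqNgt ji.
  rewrite -(trMA1 _ dV0) /A' !mulmxA mxtrace_mulC !mulmxA.
  by rewrite -!mulmxA.
(* Otherwise [u'] times the last unit row would be strictly upper triangular, and its conjugate in
   [V0] would have trace 0 and column space spanned by [u]. *)
have u'0 : u' ord_max 0 != 0.
  apply/eqP => u'0; apply: goodu.
  pose N := u' *m delta_mx 0 ord_max : 'M_n.+1.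
  have supN : strictly_upper N.
    move=> i j ji; rewrite mxE big_ord1 [X in _ * X]mxE /=.
    case: eqP => [jE|]; last by rewrite mulr0.
    suff -> : i = ord_max by rewrite u'0 mul0r.
    by apply/val_inj/eqP; rewrite /= eqn_leq -ltnS ltn_ord /= (leq_trans _ ji) // jE.
  have [NV trN] := (V0P _).1 ((PV0 N).2 supN).
  exists (invmx P *m N *m P); split=> //; split=> //.
  rewrite /N /u' !mulmxA mulVmx // mul1mx -mulmxA; apply: colspace_rank1.
  apply/eqP => dP; have := congr1 (mulmx^~ (invmx P)) dP.
  rewrite mulmxK // mul0mx => /(congr1 (fun r : 'rV_n.+1 => r 0 ord_max)) /eqP.
  by rewrite !mxE !eqxx oner_eq0.
(* The last row of [A'] is a nonzero multiple of [v'] and vanishes left of the diagonal. *)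
have v'0 (j : 'I_n.+1) : (j < n)%N -> v' 0 j = 0.
  move=> jn; have := upA' ord_max j jn; rewrite A'ij => /eqP.
  by rewrite mulf_eq0 (negbTE u'0) => /eqP.
(* Only the last diagonal entry can contribute to the trace, which is 1. *)
have A'max : A' ord_max ord_max = 1.
  have : \tr A' = 1 by rewrite /A' -mulmxA mxtrace_mulC mulmxKV.
  rewrite /mxtrace (bigD1 ord_max) //= big1 ?addr0 // => i imax.
  rewrite A'ij v'0 ?mulr0 //.
  by rewrite ltn_neqAle -ltnS ltn_ord andbT.
have A'En : En_NT A'.
  by split=> [i j ji|i ni]; [apply: upA' | rewrite A'ij v'0 ?mulr0].
exists P; split=> // M; split=> [MV|[upM diagM]].
  pose M0 := M - \tr M *: A1.
  have M0V0 : (M0 \in V0)%MS.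
    apply/V0P; split; last by rewrite linearB /= mxtraceZ trA1 mulr1 subrr.
    by rewrite linearB addmx_sub // eqmx_opp linearZ scalemx_sub.
  have supM0 : strictly_upper (P *m M0 *m invmx P) by apply/PV0; rewrite conjK.
  have -> : P *m M *m invmx P = P *m M0 *m invmx P + \tr M *: A'.
    by rewrite scalemxAl scalemxAr -mulmxDl -mulmxDr subrK.
  have [up2 diag2] := A'En; split=> [i j ji|i ni].
    by rewrite mxE supM0 ?(ltnW ji) // add0r mxE up2 // mulr0.
  by rewrite mxE supM0 // add0r mxE diag2 // mulr0.
set N := P *m M *m invmx P in upM diagM.
(* Subtracting this multiple of [A'] clears the last diagonal entry; the others are already 0. *)
have supN : strictly_upper (N - N ord_max ord_max *: A').
  have [up2 diag2] := A'En.
  move=> i j; rewrite mxE [X in _ + X]mxE [X in _ - X]mxE leq_eqVlt.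
  case/predU1P => [/val_inj ->|ji]; last by rewrite upM // up2 // mulr0 subr0.
  have [ni|ni] := ltnP i n; first by rewrite diagM // diag2 // mulr0 subr0.
  have -> : i = ord_max by apply/val_inj/eqP; rewrite /= eqn_leq ni -ltnS ltn_ord.
  by rewrite A'max mulr1 subrr.
have /PV0 := supN.
have -> : invmx P *m (N - N ord_max ord_max *: A') *m P = M - N ord_max ord_max *: A1.
  by rewrite mulmxBr mulmxBl -scalemxAr -scalemxAl /N /A' !conjK.
case/V0P=> MV _; rewrite -[M](subrK (N ord_max ord_max *: A1)) linearD addmx_sub //.
by rewrite linearZ scalemx_sub.
Qed.
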